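(* Let $a(n)$ denote the cubic partition function, defined for $n\ge 0$ by $$\sum_{n=0}^{\infty}a(n)q^n=\frac{1}{(q;q)_{\infty}(q^2;q^2)_{\infty}}.$$ Then, as an identity of formal power series in $q$ (equivalently, of analytic functions for $|q|<1$), \begin{eqnarray*} \sum_{n=0}^{\infty}a(9n+8)q^n &=& 2\cdot 3^3 \frac{(q^3;q^3)_{\infty}^{30}}{(q;q)_{\infty}^{19}(q^2;q^2)_{\infty}^{7}(q^6;q^6)_{\infty}^{6}}+8\cdot 3^3 q \frac{(q^3;q^3)_{\infty}^{21}(q^6;q^6)_{\infty}^{3}}{(q;q)_{\infty}^{16}(q^2;q^2)_{\infty}^{10}}\\ &&+19\cdot 3^4 q^2 \frac{(q^3;q^3)_{\infty}^{12}(q^6;q^6)_{\infty}^{12}}{(q;q)_{\infty}^{13}(q^2;q^2)_{\infty}^{13}} -64\cdot 3^{3} q^3 \frac{(q^3;q^3)_{\infty}^{3}(q^6;q^6)_{\infty}^{21}}{(q;q)_{\infty}^{10}(q^2;q^2)_{\infty}^{16}}\\ &&+128\cdot 3^{3}q^4 \frac{(q^6;q^6)_{\infty}^{30}}{(q;q)_{\infty}^{7}(q^2;q^2)_{\infty}^{19}(q^3;q^3)_{\infty}^{6}}. \end{eqnarray*}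
   Context: For $|q|<1$ and any $a$, $(a;q)_{\infty}=\prod_{n=0}^{\infty}(1-aq^n)$; in particular $(q^k;q^k)_\infty=\prod_{n=1}^\infty(1-q^{kn})$. *)

(* Defs.v *)
From HB Require Import structures.
From mathcomp Require Import all_boot all_order all_algebra.
From mathcomp Require Import boolp.

Set Implicit Arguments.
Unset Strict Implicit.
Unset Printing Implicit Defensive.

Import GRing.Theory.
Local Open Scope ring_scope.

(* Formal power series over R.  They are wrapped in a record because
   nat -> R already carries the pointwise ring structure. *)
Record fps (R : comUnitRingType) := Fps { fps_coef :> nat -> R }.

HB.instance Definition _ (R : comUnitRingType) := gen_eqMixin (fps R).
HB.instance Definition _ (R : comUnitRingType) := gen_choiceMixin (fps R).

Section FpsRing.
Variable R : comUnitRingType.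
Implicit Types f g h : fps R.

Lemma fpsP f g : f =1 g -> f = g.
Proof. by case: f => u; case: g => v /= /funext ->. Qed.

Definition fps_zero : fps R := Fps (fun=> 0).
Definition fps_one : fps R := Fps (fun n => (n == 0%N)%:R).
Definition fps_opp f : fps R := Fps (fun n => - f n).
Definition fps_add f g : fps R := Fps (fun n => f n + g n).
Definition fps_mul f g : fps R :=
  Fps (fun n => \sum_(i < n.+1) f i * g (n - i)%N).

Fact fps_addA : associative fps_add.
Proof. by move=> f g h; apply: fpsP => n /=; rewrite addrA. Qed.
Fact fps_addC : commutative fps_add.
Proof. by move=> f g; apply: fpsP => n /=; rewrite addrC. Qed.
Fact fps_add0 : left_id fps_zero fps_add.
Proof. by move=> f; apply: fpsP => n /=; rewrite add0r. Qed.
Fact fps_addN : left_inverse fps_zero fps_opp fps_add.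
Proof. by move=> f; apply: fpsP => n /=; rewrite addNr. Qed.

HB.instance Definition _ :=
  GRing.isZmodule.Build (fps R) fps_addA fps_addC fps_add0 fps_addN.

Let trunc N f : {poly R} := \poly_(i < N) f i.

Let coef_trunc N f n : (n < N)%N -> (trunc N f)`_n = f n.
Proof. by move=> nN; rewrite coef_poly nN. Qed.

Let coef_mul_trunc N f g n :
  (n < N)%N -> (trunc N f * trunc N g)`_n = fps_mul f g n.
Proof.
move=> nN; rewrite coefM; apply: eq_bigr => -[i /= iN] _.
by rewrite !coef_trunc // (leq_ltn_trans _ nN) ?leq_subr // -ltnS.
Qed.

Fact fps_mulC : commutative fps_mul.
Proof.
by move=> f g; apply: fpsP => n; rewrite -!(@coef_mul_trunc n.+1) // mulrC.
Qed.

Fact fps_mulA : associative fps_mul.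
Proof.
move=> f g h; apply: fpsP => n; have nn := ltnSn n.
transitivity (trunc n.+1 f * (trunc n.+1 g * trunc n.+1 h))`_n.
  rewrite coefM; apply: eq_bigr => -[i /= iN] _.
  by rewrite coef_trunc // (@coef_mul_trunc n.+1) // ltnS leq_subr.
rewrite mulrA coefM; apply: eq_bigr => -[i /= iN] _.
by rewrite (@coef_mul_trunc n.+1) // coef_trunc // ltnS leq_subr.
Qed.

Fact fps_mul1 : left_id fps_one fps_mul.
Proof.
move=> f; apply: fpsP => n /=; rewrite big_ord_recl /= mul1r subn0.
by rewrite big1 ?addr0 // => i _; rewrite mul0r.
Qed.

Fact fps_mulDl : left_distributive fps_mul fps_add.
Proof.
move=> f g h; apply: fpsP => n /=; rewrite -big_split /=.
by apply: eq_bigr => i _; rewrite mulrDl.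
Qed.

Fact fps_one_neq0 : fps_one != 0.
Proof.
by apply/eqP => /(congr1 (fun f : fps R => f 0%N)) /eqP; rewrite /= oner_eq0.
Qed.

HB.instance Definition _ :=
  GRing.Zmodule_isComNzRing.Build (fps R)
    fps_mulA fps_mulC fps_mul1 fps_mulDl fps_one_neq0.

Lemma coef_fps0 n : (0 : fps R) n = 0. Proof. by []. Qed.
Lemma coef_fps1 n : (1 : fps R) n = (n == 0%N)%:R. Proof. by []. Qed.
Lemma coef_fpsN f n : (- f) n = - f n. Proof. by []. Qed.
Lemma coef_fpsD f g n : (f + g) n = f n + g n. Proof. by []. Qed.
Lemma coef_fpsB f g n : (f - g) n = f n - g n. Proof. by []. Qed.
Lemma coef_fpsM f g n : (f * g) n = \sum_(i < n.+1) f i * g (n - i)%N.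
Proof. by []. Qed.

Lemma coef0_fpsM f g : (f * g) 0%N = f 0%N * g 0%N.
Proof. by rewrite coef_fpsM big_ord_recl big_ord0 addr0. Qed.

Lemma coef_fps_sum (I : Type) (r : seq I) (P : pred I) (F : I -> fps R) n :
  (\sum_(i <- r | P i) F i) n = \sum_(i <- r | P i) F i n.
Proof. exact: (big_morph (fun f : fps R => f n)). Qed.

Lemma coef_fpsX_lt f k n : f 0%N = 0 -> (n < k)%N -> (f ^+ k) n = 0.
Proof.
move=> f0; elim: k n => // k IHk n nk.
rewrite exprS coef_fpsM big_ord_recl f0 mul0r add0r big1 // => -[i /= iN] _.
rewrite IHk ?mulr0 // /bump /= add1n.
by rewrite ltnS in nk; apply: leq_trans nk; rewrite ltn_subrL /= (leq_ltn_trans _ iN).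
Qed.

Definition fps_unit : {pred fps R} := fun f => f 0%N \is a GRing.unit.

(* f^-1 = f_0^-1 * \sum_k (1 - f_0^-1 f)^k, of which only the terms with
   k <= n contribute to the coefficient of degree n. *)
Definition fps_inv f : fps R :=
  if fps_unit f then
    Fps (fun n => (f 0%N)^-1 *
      \sum_(k < n.+1) ((1 - Fps (fun i => (f 0%N)^-1 * f i)) ^+ k) n)
  else f.

Fact fps_mulV : {in fps_unit, left_inverse 1 fps_inv *%R}.
Proof.
move=> f uf; rewrite /fps_inv (uf : fps_unit f = true).
set c := (f 0%N)^-1; set h := 1 - Fps (fun i => c * f i).
have h0 : h 0%N = 0 by rewrite coef_fpsB coef_fps1 /= mulVr // subrr.
apply: fpsP => n; rewrite mulrC.
transitivity (((1 - h) * \sum_(k < n.+1) h ^+ k) n); last first.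
  by rewrite -opprB mulNr -subrX1 opprB coef_fpsB (coef_fpsX_lt h0) ?subr0.
rewrite !coef_fpsM; apply: eq_bigr => -[i /= iN] _.
rewrite subKr mulrCA mulrA; congr (_ * _).
rewrite coef_fps_sum -!(big_mkord xpredT (fun k => (h ^+ k) (n - i)%N)).
rewrite [RHS](big_cat_nat (n := (n - i).+1)) //= ?ltnS ?leq_subr //.
rewrite [X in _ + X]big_nat_cond [X in _ + X]big1 ?addr0 // => k.
by case/andP=> /andP[nik _] _; apply: coef_fpsX_lt.
Qed.

Fact fps_unitP f g : g * f = 1 -> fps_unit f.
Proof.
move/(congr1 (fun u : fps R => u 0%N)); rewrite coef0_fpsM coef_fps1 /= => gf.
by apply/unitrPr; exists (g 0%N); rewrite mulrC.
Qed.

Fact fps_inv_out : {in [predC fps_unit], fps_inv =1 id}.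
Proof. by move=> f /negbTE nf; rewrite /fps_inv (nf : fps_unit f = false). Qed.

HB.instance Definition _ :=
  GRing.ComNzRing_hasMulInverse.Build (fps R) fps_mulV fps_unitP fps_inv_out.

Lemma fps_unitE f : (f \is a GRing.unit) = (f 0%N \is a GRing.unit).
Proof. by []. Qed.

Definition fpsX : fps R := Fps (fun n => (n == 1%N)%:R).

(* (a; q)_oo = \prod_(i >= 0) (1 - a q^i) for series a and q with q_0 = 0: the
   factors with i > n do not affect the coefficient of degree n, see
   coef_qpoch. *)
Definition qpoch (a q : fps R) : fps R :=
  Fps (fun n => (\prod_(i < n.+1) (1 - a * q ^+ i)) n).

Lemma coef_qpoch (a q : fps R) (n N : nat) :
  q 0%N = 0 -> (n < N)%N ->
  qpoch a q n = (\prod_(i < N) (1 - a * q ^+ i)) n.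
Proof.
move=> q0; elim: N => // N IHN; rewrite ltnS leq_eqVlt.
case/predU1P => [->//|nN]; rewrite (IHN nN); set P := \prod_(i < N) _.
have -> : \prod_(i < N.+1) (1 - a * q ^+ i) = P * (1 - a * q ^+ N).
  by rewrite big_ord_recr.
suff z : (P * (a * q ^+ N)) n = 0 by rewrite mulrBr mulr1 coef_fpsB z subr0.
rewrite mulrA coef_fpsM big1 // => -[i /= iN] _.
by rewrite (coef_fpsX_lt q0) ?mulr0 // (leq_ltn_trans _ nN) // leq_subr.
Qed.

Lemma qpoch_unit (a q : fps R) : a 0%N = 0 -> qpoch a q \is a GRing.unit.
Proof.
move=> a0; rewrite fps_unitE /= big_ord_recl big_ord0 mulr1 expr0 mulr1.
by rewrite coef_fpsB a0 subr0 unitr1.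
Qed.

End FpsRing.

Arguments fpsX {R}.

(* The Euler product (q^k; q^k)_oo; it is a unit for k > 0. *)
Definition euler (k : nat) : fps int := qpoch (fpsX ^+ k) (fpsX ^+ k).

Lemma coef_fpsXn (R : comUnitRingType) (k n : nat) :
  (fpsX ^+ k : fps R) n = (n == k)%:R.
Proof.
elim: k n => [|k IHk] n; first by rewrite expr0 coef_fps1.
rewrite exprS coef_fpsM big_ord_recl /= mul0r add0r.
case: n => [|n]; first by rewrite big_ord0.
rewrite big_ord_recl /= mul1r subSS subn0 IHk eqSS.
by rewrite big1 ?addr0 // => i _; rewrite mul0r.
Qed.

Lemma euler_unit (k : nat) : (0 < k)%N -> euler k \is a GRing.unit.
Proof. by case: k => // k _; apply: qpoch_unit; rewrite coef_fpsXn. Qed.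

Definition cubic_partition (n : nat) : int := (1 / (euler 1 * euler 2)) n.

(* Main.v *)
Require Import Defs.
From HB Require Import structures.
From mathcomp Require Import all_boot all_order all_algebra all_field.
From mathcomp Require Import ring zify.

(* Write E_k for (q^k; q^k)_oo and x = E_3 E_18^3 / (E_6 E_9^3).  Jacobi's triple
   product gives E_1 E_2 = (E_1^2/E_2) (E_2^2/E_1) as a product of two theta
   series; splitting the summation index modulo 3 in both and applying the
   triple product again yields the 3-dissection
     E_1 E_2 = E_9 E_18 (1/x - q - 2 q^2 x).
   Multiplying it over q, wq, w^2 q, where w is a primitive cube root of unity,
   gives
     (E_3 E_6)^4 = (E_9 E_18)^4 (1/x^3 - 7 q^3 - 8 q^6 x^3),
   hence
     1/(E_1 E_2) = (E_9 E_18)^3 / (E_3 E_6)^4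
                   (1/x^2 - 2 q^3 x + q (1/x + 4 q^3 x^2) + 3 q^2).
   So the series of the a(3n+2) is 3 (E_3 E_6)^3 / (E_1 E_2)^4, and extracting
   the exponents 2 mod 3 once more from the fourth power of the last display
   gives the theorem.  The integer identity is proved over algC, which
   contains w. *)

Set Implicit Arguments.
Unset Strict Implicit.
Unset Printing Implicit Defensive.

Import GRing.Theory Num.Theory.
Local Open Scope ring_scope.

(** * Congruences modulo q^N and infinite products *)

Lemma big_ord_mul (T : Type) (idx : T) (op : Monoid.com_law idx)
    (F : nat -> T) m N :
  \big[op/idx]_(j < N * m) F j =
  \big[op/idx]_(r < m) \big[op/idx]_(i < N) F (r + m * i)%N.
Proof.
elim: N => [|N IHN]; first by rewrite big_ord0 big1 // => r _; rewrite big_ord0.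
rewrite mulSn addnC big_split_ord /= IHN -big_split /=.
by apply: eq_bigr => r _; rewrite big_ord_recr /= mulnC addnC.
Qed.

Section Congruence.
Variable R : comUnitRingType.
Implicit Types (f g h a q : fps R) (N : nat).

Definition fps_eqmod N f g := forall n, (n < N)%N -> f n = g n.

Lemma fps_eqmodP f g : (forall N, fps_eqmod N f g) -> f = g.
Proof. by move=> fg; apply: fpsP => n; apply: (fg n.+1). Qed.

Lemma eqmod_eq N f g : f = g -> fps_eqmod N f g.
Proof. by move=> ->. Qed.

Lemma eqmod_sym N f g : fps_eqmod N f g -> fps_eqmod N g f.
Proof. by move=> fg n nN; rewrite fg. Qed.

Lemma eqmod_trans N f g h :
  fps_eqmod N f g -> fps_eqmod N g h -> fps_eqmod N f h.
Proof. by move=> fg gh n nN; rewrite fg ?gh. Qed.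

Lemma eqmodD N f1 g1 f2 g2 : fps_eqmod N f1 g1 -> fps_eqmod N f2 g2 ->
  fps_eqmod N (f1 + f2) (g1 + g2).
Proof. by move=> e1 e2 n nN; rewrite !coef_fpsD e1 ?e2. Qed.

Lemma eqmodM N f1 g1 f2 g2 : fps_eqmod N f1 g1 -> fps_eqmod N f2 g2 ->
  fps_eqmod N (f1 * f2) (g1 * g2).
Proof.
move=> e1 e2 n nN; rewrite !coef_fpsM; apply: eq_bigr => -[i /= iN] _.
by rewrite e1 ?e2 //; lia.
Qed.

Lemma eqmod_sum N (I : Type) (r : seq I) (P : pred I) (F G : I -> fps R) :
  (forall i, P i -> fps_eqmod N (F i) (G i)) ->
  fps_eqmod N (\sum_(i <- r | P i) F i) (\sum_(i <- r | P i) G i).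
Proof.
by move=> FG n nN; rewrite !coef_fps_sum; apply: eq_bigr => i /FG; apply.
Qed.

Lemma eqmod_prod N (I : Type) (r : seq I) (P : pred I) (F G : I -> fps R) :
  (forall i, P i -> fps_eqmod N (F i) (G i)) ->
  fps_eqmod N (\prod_(i <- r | P i) F i) (\prod_(i <- r | P i) G i).
Proof. by move=> FG; elim/big_ind2: _ => // *; apply: eqmodM. Qed.

Lemma eqmodX0 N q k f : q 0%N = 0 -> (N <= k)%N -> fps_eqmod N (q ^+ k * f) 0.
Proof.
move=> q0 Nk n nN; rewrite coef_fpsM big1 // => -[i /= iN] _.
by rewrite coef_fpsX_lt ?mul0r //; lia.
Qed.

Lemma qpoch_eqmod N M a q : q 0%N = 0 -> (N <= M)%N ->
  fps_eqmod N (qpoch a q) (\prod_(i < M) (1 - a * q ^+ i)).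
Proof. by move=> q0 NM n nN; apply: coef_qpoch => //; lia. Qed.

Lemma coef0_fpsX q k : q 0%N = 0 -> (0 < k)%N -> (q ^+ k) 0%N = 0.
Proof. by move=> q0 k0; apply: coef_fpsX_lt. Qed.

(** The factors are sorted by the residue of their index modulo m; truncating at [N * m] of them
    makes the rearrangement finite. *)
Lemma qpoch_dissect a q m : q 0%N = 0 -> (0 < m)%N ->
  qpoch a q = \prod_(r < m) qpoch (a * q ^+ r) (q ^+ m).
Proof.
move=> q0 m0; apply: fps_eqmodP => N.
apply: (@eqmod_trans _ _ (\prod_(j < N * m) (1 - a * q ^+ j))).
  by apply: qpoch_eqmod => //; apply: leq_pmulr.
rewrite (big_ord_mul _ (fun j => 1 - a * q ^+ j)); apply: eqmod_prod => r _.
under eq_bigr do rewrite exprD exprM mulrA.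
by apply/eqmod_sym/qpoch_eqmod; rewrite ?coef0_fpsX.
Qed.

Lemma qpoch_dissect2 a q : q 0%N = 0 ->
  qpoch a q = qpoch a (q ^+ 2) * qpoch (a * q) (q ^+ 2).
Proof.
move=> q0; rewrite (@qpoch_dissect a q 2) // 2!big_ord_recl big_ord0.
by rewrite expr0 !mulr1.
Qed.

Lemma qpoch_dissect3 a q : q 0%N = 0 ->
  qpoch a q = qpoch a (q ^+ 3) * qpoch (a * q) (q ^+ 3)
    * qpoch (a * q ^+ 2) (q ^+ 3).
Proof.
move=> q0; rewrite (@qpoch_dissect a q 3) // 3!big_ord_recl big_ord0.
by rewrite expr0 !mulr1 mulrA.
Qed.

Lemma qpoch_rec a q : q 0%N = 0 -> qpoch a q = (1 - a) * qpoch (a * q) q.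
Proof.
move=> q0; apply: fps_eqmodP => N.
apply: (eqmod_trans (qpoch_eqmod a q0 (leqnSn N))).
rewrite big_ord_recl expr0 mulr1; apply: eqmodM => //.
under eq_bigr do rewrite /= exprS mulrA.
exact/eqmod_sym/qpoch_eqmod.
Qed.

Lemma qpochN a q : q 0%N = 0 ->
  qpoch (- a) q * qpoch a q = qpoch (a ^+ 2) (q ^+ 2).
Proof.
move=> q0; apply: fps_eqmodP => N.
apply: (eqmod_trans (eqmodM (qpoch_eqmod _ q0 (leqnn N))
                            (qpoch_eqmod _ q0 (leqnn N)))).
rewrite -big_split /=.
apply: eqmod_trans; last first.
  by apply/eqmod_sym; apply: qpoch_eqmod (leqnn N); rewrite coef0_fpsX.
apply: eqmod_prod => i _; rewrite -exprM mulnC exprM.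
by apply: eqmod_eq; ring.
Qed.

(** Factor by factor this is (1 - u)(1 - w u)(1 - w^2 u) = 1 - u^3, where every power of w is
    reduced by w^2 = -1 - w. *)
Lemma qpoch_cube (w : fps R) a q : 1 + w + w ^+ 2 = 0 -> q 0%N = 0 ->
  qpoch a q * qpoch (w * a) q * qpoch (w ^+ 2 * a) q = qpoch (a ^+ 3) (q ^+ 3).
Proof.
move=> w0 q0; apply: fps_eqmodP => N.
apply: (eqmod_trans (eqmodM (eqmodM (qpoch_eqmod _ q0 (leqnn N))
    (qpoch_eqmod _ q0 (leqnn N))) (qpoch_eqmod _ q0 (leqnn N)))).
rewrite -!big_split /=.
apply: eqmod_trans; last first.
  by apply/eqmod_sym; apply: qpoch_eqmod (leqnn N); rewrite coef0_fpsX.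
apply: eqmod_prod => i _.
rewrite -exprM mulnC exprM; set u := q ^+ i; apply: eqmod_eq.
have -> : w ^+ 2 = - 1 - w by rewrite -[RHS]add0r -w0; ring.
have w2 : w * w = - 1 - w by rewrite -[RHS]add0r -w0; ring.
transitivity (1 - (a * u) * (1 + w + (- 1 - w))
    + (a * u) ^+ 2 * (w + (-1 - w) + w * (-1 - w))
    - (a * u) ^+ 3 * (w * (-1 - w))); first by ring.
have -> : w * (-1 - w) = 1 by rewrite mulrBr w2; ring.
ring.
Qed.

End Congruence.

(** * A finite form of Jacobi's triple product *)

Lemma bin2D m n : 'C(m + n, 2) = ('C(m, 2) + 'C(n, 2) + m * n)%N.
Proof.
elim: n => [|n IHn]; first by rewrite addn0 bin0n muln0 !addn0.
by rewrite addnS !binS !bin1 IHn; lia.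
Qed.

Lemma bin2_double n : ('C(n, 2) * 2 + n = n * n)%N.
Proof. by elim: n => // n IHn; rewrite binS bin1; lia. Qed.

Section FiniteJacobi.
Variables (R : comNzRingType) (q : R).

(** Gaussian binomial coefficients, introduced by a q-Pascal rule so that no division occurs. *)
Fixpoint gbinom n k : R :=
  match n, k with
  | _, 0 => 1
  | 0, _.+1 => 0
  | n'.+1, k'.+1 => gbinom n' k'.+1 + q ^+ (n' - k') * gbinom n' k'
  end.

Lemma gbinom_small n k : (n < k)%N -> gbinom n k = 0.
Proof.
elim: n k => [|n IHn] [|k] //= nk.
by rewrite !IHn ?mulr0 ?addr0 //; lia.
Qed.

Definition qfact n : R := \prod_(i < n) (1 - q * q ^+ i).

Lemma qfactS n : qfact n.+1 = qfact n * (1 - q ^+ n.+1).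
Proof. by rewrite /qfact big_ord_recr /= exprS. Qed.

Lemma gbinom0 n : gbinom n 0 = 1. Proof. by case: n. Qed.

(** Pascal's rule reduces the induction to (1 - q^(n-k)) + q^(n-k) (1 - q^(k+1)) = 1 - q^(n+1). *)
Lemma gbinom_fact n k : (k <= n)%N ->
  gbinom n k * qfact k * qfact (n - k) = qfact n.
Proof.
elim: n k => [|n IHn] [|k] // kn.
- by rewrite gbinom0 /qfact !big_ord0 !mul1r.
- by rewrite gbinom0 {1}/qfact big_ord0 !mul1r subn0.
rewrite subSS /= mulrDl mulrDl.
have E : q ^+ (n - k) * gbinom n k * qfact k.+1 * qfact (n - k) =
    (q ^+ (n - k) * (1 - q ^+ k.+1)) * qfact n.
  by rewrite qfactS -(IHn k kn); ring.
rewrite E [RHS]qfactS; have [kn'|nk] := ltnP k n; last first.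
  have -> : k = n by lia.
  by rewrite gbinom_small // subnn expr0; ring.
have e : (n - k = (n - k.+1).+1)%N by lia.
have e' : q ^+ n.+1 = q ^+ (n - k) * q ^+ k.+1.
  by rewrite -exprD; congr (_ ^+ _); lia.
have -> : qfact (n - k) = qfact (n - k.+1) * (1 - q ^+ (n - k)).
  by rewrite e qfactS.
by rewrite e' -(IHn k.+1 kn'); ring.
Qed.

(** In the product with the new factor y + q^n, the summand y keeps the coefficients and q^n
    supplies the second term of Pascal's rule, because C(k+1,2) = C(k,2) + k. *)
Lemma gbinom_thm y n :
  \prod_(i < n) (y + q ^+ i) =
  \sum_(k < n.+1) gbinom n k * q ^+ 'C(k, 2) * y ^+ (n - k).
Proof.
elim: n => [|n IHn].
  by rewrite big_ord0 big_ord_recl big_ord0 bin0n !expr0 !mulr1 addr0.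
rewrite big_ord_recr /= IHn mulrDr [RHS]big_ord_recl /= bin0n mulr1 subn0.
have -> : \sum_(i < n.+1) (gbinom n i.+1 + q ^+ (n - i) * gbinom n i)
      * q ^+ 'C(i.+1, 2) * y ^+ (n.+1 - i.+1) =
    \sum_(i < n.+1) gbinom n i.+1 * q ^+ 'C(i.+1, 2) * y ^+ (n - i) +
    \sum_(i < n.+1) (gbinom n i * q ^+ 'C(i, 2) * y ^+ (n - i)) * q ^+ n.
  rewrite -big_split /=; apply: eq_bigr => -[i /= iN] _.
  rewrite subSS !mulrDl; congr (_ + _).
  have -> : q ^+ n = q ^+ (n - i) * q ^+ i by rewrite -exprD; congr (_ ^+ _); lia.
  by rewrite binS bin1 exprD; ring.
rewrite addrA -mulr_suml; congr (_ + _).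
rewrite [in RHS]big_ord_recr /= gbinom_small // !mul0r addr0 big_ord_recl /=.
rewrite gbinom0 bin0n mulr1 subn0 mulrDl mul1r mul1r -exprSr; congr (_ + _).
rewrite mulr_suml; apply: eq_bigr => -[i /= iN] _.
by rewrite -mulrA -exprSr; congr (_ * _ ^+ _); rewrite /bump /=; lia.
Qed.

(* Substitute y = b q^m in the q-binomial theorem for 2(m+1) factors and cancel
   q^(m(m+1)/2) (b q^m)^(m+1). *)
Lemma finite_jacobi a b m : a * b = q -> GRing.lreg b -> GRing.lreg q ->
  \prod_(i < m.+1) ((1 + a * q ^+ i) * (1 + b * q ^+ i)) =
  \sum_(j < m.+2) gbinom (m.+1 + m.+1) (m.+1 + j) * (q ^+ 'C(j, 2) * a ^+ j)
  + b * \sum_(j < m.+1) gbinom (m.+1 + m.+1) (m - j)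
                          * (q ^+ 'C(j, 2) * (b * q) ^+ j).
Proof.
move=> abq regb regq; pose y := b * q ^+ m.
have regK : GRing.lreg (q ^+ 'C(m.+1, 2) * y ^+ m.+1).
  by apply: lregM; [exact: lregX | apply/lregX/lregM/lregX].
apply: regK.
(* The lower half of the 2(m+1) factors: y + q^i = q^i (1 + b q^(m-i)), read in reverse order. *)
have P1 : \prod_(i < m.+1) (y + q ^+ i) =
    q ^+ 'C(m.+1, 2) * \prod_(i < m.+1) (1 + b * q ^+ i).
  have -> : 'C(m.+1, 2) = (\sum_(i < m.+1) i)%N by rewrite -bin2_sum big_mkord.
  rewrite (big_morph _ (exprD q) (expr0 q)) [X in _ * X](reindex_inj rev_ord_inj).
  rewrite -big_split; apply: eq_bigr => -[i /= im] _.
  have -> : y = q ^+ i * (b * q ^+ (m.+1 - i.+1)).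
    by rewrite mulrCA -exprD /y; congr (_ * _ ^+ _); lia.
  ring.
(* The upper half: q^(m+1+i) = a b q^m q^i = y a q^i. *)
have P2 : \prod_(i < m.+1) (y + q ^+ (m.+1 + i)) =
    y ^+ m.+1 * \prod_(i < m.+1) (1 + a * q ^+ i).
  transitivity (\prod_(i < m.+1) (y * (1 + a * q ^+ i))).
    apply: eq_bigr => i _.
    have -> : q ^+ (m.+1 + i) = a * b * q ^+ m * q ^+ i.
      by rewrite exprD exprS abq.
    by rewrite /y; ring.
  by rewrite big_split /= prodr_const card_ord.
transitivity (\prod_(i < m.+1 + m.+1) (y + q ^+ i)).
  by rewrite big_split_ord /= P1 P2 big_split /=; ring.
(* The binomial sum is cut at k = m+1: the indices k = m+1+j give the powers of a, and k = m-j those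
   of b. *)
rewrite gbinom_thm -addnS big_split_ord /= addrC mulrDr; congr (_ + _).
  rewrite mulr_sumr; apply: eq_bigr => -[j /= jm] _.
  rewrite mulrCA -mulrA; congr (_ * _).
  have -> : (m.+1 + m.+1 - (m.+1 + j) = m.+1 - j)%N by lia.
  have -> : y ^+ m.+1 = y ^+ (m.+1 - j) * y ^+ j.
    by rewrite -exprD; congr (_ ^+ _); lia.
  have -> : q ^+ 'C(m.+1 + j, 2) =
      q ^+ 'C(m.+1, 2) * q ^+ 'C(j, 2) * (q ^+ m) ^+ j * (a * b) ^+ j.
    by rewrite abq -exprM -!exprD; congr (_ ^+ _); rewrite bin2D; lia.
  by rewrite /y !exprMn; ring.
rewrite (reindex_inj rev_ord_inj) !mulr_sumr; apply: eq_bigr => -[j /= jm] _.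
have -> : (m.+1 - j.+1 = m - j)%N by lia.
have key : q ^+ 'C(m - j, 2) * y ^+ (m.+1 + m.+1 - (m - j)) =
    q ^+ 'C(m.+1, 2) * y ^+ m.+1 * (b * (q ^+ 'C(j, 2) * (b * q) ^+ j)).
  have -> : (m.+1 + m.+1 - (m - j) = m.+1 + j.+1)%N by lia.
  have qE : q ^+ 'C(m - j, 2) * (q ^+ m) ^+ j.+1 =
      q ^+ 'C(m.+1, 2) * q ^+ 'C(j, 2) * q ^+ j.
    rewrite -exprM -!exprD; congr (_ ^+ _).
    have -> : (m.+1 = (m - j) + j.+1)%N by lia.
    by rewrite bin2D binS bin1; have := bin2_double j; nia.
  transitivity (q ^+ 'C(m - j, 2) * (q ^+ m) ^+ j.+1 * y ^+ m.+1 * b ^+ j.+1).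
    by rewrite exprD [y ^+ j.+1]exprMn; ring.
  by rewrite qE [(b * q) ^+ j]exprMn [b ^+ _]exprS; ring.
by rewrite -mulrA key; ring.
Qed.

End FiniteJacobi.

(** * Theta series *)

Section Theta.
Variable R : comUnitRingType.
Implicit Types (a b q z : fps R) (N : nat).

(** Half of a theta series, the sum over j >= 0. When q has no constant term the cutoff is exact for
    every z, even z = 1: C(j,2) > n from j = n+2 on, while j = n+1 may still contribute for n = 0
    and n = 1. *)
Definition ptheta q z : fps R :=
  Fps (fun n => (\sum_(j < n.+2) q ^+ 'C(j, 2) * z ^+ j) n).

Lemma bin2_geq j N : (N < j)%N -> (N <= 'C(j, 2))%N.
Proof. by have := bin2_double j; nia. Qed.

Lemma ptheta_eqmod N M q z : q 0%N = 0 -> (N < M)%N ->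
  fps_eqmod N (ptheta q z) (\sum_(j < M) q ^+ 'C(j, 2) * z ^+ j).
Proof.
move=> q0 NM n nN; have -> : M = (n.+2 + (M - n.+2))%N by lia.
rewrite big_split_ord coef_fpsD -[LHS]addr0; congr (_ + _).
rewrite coef_fps_sum big1 // => i _.
by rewrite (@eqmodX0 _ n.+1) //; apply: bin2_geq => /=; lia.
Qed.

(* Ramanujan's theta function [\sum_(j in Z) a^(j(j+1)/2) b^(j(j-1)/2)], split
   into j >= 0 and j < 0. *)
Definition theta a b : fps R :=
  ptheta (a * b) a + b * ptheta (a * b) (b * (a * b)).

(** With j = 3i + r, one has C(j,2) = 9 C(i,2) + 3(r+1) i + C(r,2). *)
Lemma ptheta_dissect3 q z : q 0%N = 0 ->
  ptheta q z = ptheta (q ^+ 9) (z ^+ 3 * q ^+ 3)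
    + z * ptheta (q ^+ 9) (z ^+ 3 * q ^+ 6)
    + z ^+ 2 * q * ptheta (q ^+ 9) (z ^+ 3 * q ^+ 9).
Proof.
move=> q0; apply: fps_eqmodP => N; have q90 := coef0_fpsX q0 (isT : 0 < 9)%N.
apply: (@eqmod_trans _ _ _ (\sum_(j < N.+1 * 3) q ^+ 'C(j, 2) * z ^+ j)).
  by apply: ptheta_eqmod => //; lia.
rewrite (big_ord_mul _ (fun j => q ^+ 'C(j, 2) * z ^+ j)).
pose F r := \sum_(i < N.+1) q ^+ 'C(r + 3 * i, 2) * z ^+ (r + 3 * i).
have -> : \sum_(r < 3) F r = F 0%N + F 1%N + F 2%N.
  by rewrite !big_ord_recl big_ord0 /= addr0 addrA.
rewrite {}/F.
have b3 i : ('C(3 * i, 2) = 9 * 'C(i, 2) + 3 * i)%N.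
  by have := bin2_double i; have := bin2_double (3 * i); nia.
have ptE c d e : (forall i, q ^+ 'C(c + 3 * i, 2) * z ^+ (c + 3 * i) =
     d * (q ^+ 9 ^+ 'C(i, 2) * e ^+ i)) ->
   fps_eqmod N (\sum_(i < N.+1) q ^+ 'C(c + 3 * i, 2) * z ^+ (c + 3 * i))
     (d * ptheta (q ^+ 9) e).
  move=> cde; under eq_bigr do rewrite cde.
  rewrite -mulr_sumr; apply: eqmodM => //; apply: eqmod_sym.
  exact: ptheta_eqmod.
apply: eqmodD; first apply: eqmodD.
- rewrite -[ptheta _ _]mul1r; apply: ptE => i.
  by rewrite add0n mul1r b3 exprD [(z ^+ 3 * _) ^+ i]exprMn -!exprM; ring.
- apply: ptE => i; have -> : ('C(1 + 3 * i, 2) = 9 * 'C(i, 2) + 6 * i)%N.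
    by rewrite bin2D b3 bin_small //; lia.
  by rewrite exprD [(z ^+ 3 * _) ^+ i]exprMn [z ^+ (1 + _)]exprS -!exprM; ring.
apply: ptE => i; have -> : ('C(2 + 3 * i, 2) = 1 + (9 * 'C(i, 2) + 9 * i))%N.
  by rewrite bin2D b3 binn; lia.
rewrite [q ^+ (1 + _)]exprS exprD [(z ^+ 3 * _) ^+ i]exprMn.
by rewrite [z ^+ (_ + _)]exprD -!exprM; ring.
Qed.

(** Both halves of the series are dissected, and each of the three theta series on the right takes
    one piece from either half. *)
Lemma theta_dissect3 a b : (a * b) 0%N = 0 ->
  theta a b = theta (a ^+ 6 * b ^+ 3) (a ^+ 3 * b ^+ 6)
    + a * theta (a ^+ 9 * b ^+ 6) (b ^+ 3)
    + b * theta (b ^+ 9 * a ^+ 6) (a ^+ 3).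
Proof.
move=> ab0; rewrite {1}/theta !(ptheta_dissect3 _ ab0) /theta.
have -> : a ^+ 6 * b ^+ 3 * (a ^+ 3 * b ^+ 6) = (a * b) ^+ 9 by ring.
have -> : a ^+ 9 * b ^+ 6 * b ^+ 3 = (a * b) ^+ 9 by ring.
have -> : b ^+ 9 * a ^+ 6 * a ^+ 3 = (a * b) ^+ 9 by ring.
set T := ptheta _.
have -> : a ^+ 3 * (a * b) ^+ 3 = a ^+ 6 * b ^+ 3 by ring.
have -> : a ^+ 3 * (a * b) ^+ 6 = a ^+ 9 * b ^+ 6 by ring.
have -> : (b * (a * b)) ^+ 3 * (a * b) ^+ 3 = b ^+ 9 * a ^+ 6 by ring.
have -> : (b * (a * b)) ^+ 3 * (a * b) ^+ 6 = b ^+ 3 * (a * b) ^+ 9 by ring.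
have -> : (b * (a * b)) ^+ 3 * (a * b) ^+ 9 = a ^+ 3 * b ^+ 6 * (a * b) ^+ 9.
  by ring.
by move: (T _) (T _) (T _) (T _) (T _) (T _) => t1 t2 t3 t4 t5 t6; ring.
Qed.

Lemma qfact_eqmod N n q : q 0%N = 0 -> (N <= n)%N ->
  fps_eqmod N (qpoch q q) (qfact q n).
Proof. exact: qpoch_eqmod. Qed.

(** The quotient qfact n / (qfact k qfact (n-k)) tends to 1/(q;q)_oo, since all three indices are at
    least N. *)
Lemma gbinom_eqmod N n k q : q 0%N = 0 -> (N <= k)%N -> (N + k <= n)%N ->
  fps_eqmod N (gbinom q n k * qpoch q q) 1.
Proof.
move=> q0 Nk Nkn; have uE := qpoch_unit q q0.
rewrite -(mulrK uE (_ * _)) -[1](mulrV uE); apply: eqmodM => //.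
apply: (@eqmod_trans _ _ _ (gbinom q n k * qfact q k * qfact q (n - k))).
  by apply: eqmodM; [apply: eqmodM|] => //; apply: qfact_eqmod => //; lia.
rewrite gbinom_fact; last by lia.
by apply/eqmod_sym/qfact_eqmod => //; lia.
Qed.

(** This is the limit of [finite_jacobi]; regularity of b and ab is what the cancellation there
    requires. *)
Lemma jacobi_triple a b : (a * b) 0%N = 0 ->
  GRing.lreg b -> GRing.lreg (a * b) ->
  theta a b = qpoch (- a) (a * b) * qpoch (- b) (a * b) * qpoch (a * b) (a * b).
Proof.
move=> q0 regb regq; set q := a * b in q0 regq *; apply: fps_eqmodP => N.
(* Terms with j > N vanish modulo q^N. For j <= N the choice m = 2N keeps both k and 2(m+1) - k at
   least N, so that [gbinom_eqmod] applies. *)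
pose m := (2 * N)%N; have Nm : (N < m.+1)%N by lia.
have E k (z : fps R) j : (m - k <= j)%N -> (k <= m.+1 + m.+1)%N ->
    (m.+1 - (m.+1 + m.+1 - k) <= j)%N ->
  fps_eqmod N (q ^+ 'C(j, 2) * z ^+ j)
   (gbinom q (m.+1 + m.+1) k * (q ^+ 'C(j, 2) * z ^+ j) * qpoch q q).
  move=> k1 k2 k3; have [jN|Nj] := leqP j N; last first.
    apply: (eqmod_trans (eqmodX0 _ q0 (bin2_geq Nj))).
    apply: eqmod_sym; rewrite mulrCA -mulrA.
    by apply: eqmodX0 => //; apply: bin2_geq.
  rewrite mulrAC -[X in fps_eqmod _ X]mul1r; apply: eqmodM => //.
  by apply/eqmod_sym/gbinom_eqmod => //; lia.
apply: eqmod_sym; apply: eqmod_trans.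
  apply: eqmodM; first apply: eqmodM; last by [].
    exact: (qpoch_eqmod _ q0 (ltnW Nm)).
  exact: (qpoch_eqmod _ q0 (ltnW Nm)).
under eq_bigr do rewrite mulNr opprK.
under [X in _ * X * _]eq_bigr do rewrite mulNr opprK.
rewrite -big_split (finite_jacobi _ (erefl q)) // mulrDl.
apply/eqmod_sym/eqmodD.
  apply: (eqmod_trans (ptheta_eqmod a q0 (leqW Nm))).
  rewrite mulr_suml; apply: eqmod_sum => j _; have jm := ltn_ord j.
  by apply: E; lia.
rewrite -mulrA; apply: eqmodM => //.
apply: (eqmod_trans (ptheta_eqmod _ q0 Nm)).
rewrite mulr_suml; apply: eqmod_sum => j _; have jm := ltn_ord j.
by apply: E; lia.
Qed.

End Theta.

(** * The 3-dissection of E_1 E_2 *)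

Section ThetaProducts.
Variables (R : comUnitRingType) (q : fps R).
Hypotheses (q0 : q 0%N = 0) (regq : GRing.lreg q).

Let E n : fps R := qpoch (q ^+ n) (q ^+ n).

Let qX0 n : (q ^+ n.+1) 0%N = 0.
Proof. exact: coef0_fpsX. Qed.

(** The splitting into j >= 0 and j < 0 hides the symmetry; the triple product displays it. *)
Lemma theta_sym (a b : fps R) : (a * b) 0%N = 0 ->
  GRing.lreg a -> GRing.lreg b -> theta a b = theta b a.
Proof.
move=> ab0 rega regb; have regab := lregM rega regb.
rewrite (jacobi_triple ab0 regb regab); rewrite mulrC in ab0 regab.
by rewrite (jacobi_triple ab0 rega regab) [b * a]mulrC [qpoch (- b) _ * _]mulrC.
Qed.

Lemma jacobi_triple_eq (a b c : fps R) : a * b = c -> c 0%N = 0 ->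
    GRing.lreg b -> GRing.lreg c ->
  theta a b = qpoch (- a) c * qpoch (- b) c * qpoch c c.
Proof. by move=> <-; apply: jacobi_triple. Qed.

(** Ramanujan's phi(-q), the sum of (-1)^j q^(j^2) over all integers j. *)
Lemma theta_phi : theta (- q) (- q) * E 2 = E 1 ^+ 2.
Proof.
have e : - q * - q = q ^+ 2 by rewrite mulrNN.
rewrite (jacobi_triple_eq e (qX0 _) (lregN regq) (lregX regq)).
have -> : E 1 = qpoch q (q ^+ 2) * E 2.
  exact: (qpoch_dissect2 q q0).
by rewrite opprK exprMn [E 2 ^+ 2]expr2 mulrA.
Qed.

(** [theta 1 q] is twice Ramanujan's psi(q); the 2 is the first factor of (-1; q)_oo. *)
Lemma theta_psi : theta 1 q * E 1 = 2 * E 2 ^+ 2.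
Proof.
rewrite (jacobi_triple_eq (mul1r q) q0 regq regq) (qpoch_rec _ q0) mulN1r opprK.
have -> : E 2 = qpoch (- q) q * E 1 by rewrite /E -(qpochN q q0).
rewrite exprMn [E 1]/E !expr2 -natr1 mulr1n !mulrA.
by congr (_ * _).
Qed.

(** The triple product lacks only (-q^3; q^3)_oo = E_6/E_3 to contain all of (-q; q)_oo =
    E_2/E_1. *)
Lemma theta_cubic : theta (q ^+ 2) q * (E 1 * E 6) = E 2 * E 3 ^+ 2.
Proof.
have e : q ^+ 2 * q = q ^+ 3 by rewrite -exprSr.
have q30 := qX0 2.
rewrite (jacobi_triple_eq e q30 regq (lregX regq)).
have -> : E 6 = qpoch (- q ^+ 3) (q ^+ 3) * E 3.
  by rewrite (qpochN _ q30) -exprM.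
have -> : E 2 = qpoch (- q) (q ^+ 3) * qpoch (- q ^+ 2) (q ^+ 3) *
     qpoch (- q ^+ 3) (q ^+ 3) * E 1.
  rewrite [E 2]/E -(qpochN q q0); congr (_ * _).
  by rewrite (qpoch_dissect3 _ q0) !mulNr -expr2 -exprS.
rewrite -/(E 3).
move: (qpoch _ _) (qpoch _ _) (qpoch _ _) (E 1) (E 3) => A B C D F; ring.
Qed.

(** Splitting the odd exponents modulo 6, the triple product contains (q; q^2)_oo = E_1/E_2 without
    (q^3; q^6)_oo = E_3/E_6. *)
Lemma theta_omega : theta (- q ^+ 5) (- q) * (E 2 * E 3) = E 1 * E 6 ^+ 2.
Proof.
have e : - q ^+ 5 * - q = q ^+ 6 by rewrite mulrNN -exprSr.
rewrite (jacobi_triple_eq e (qX0 _) (lregN regq) (lregX regq)).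
have -> : E 1 = qpoch q (q ^+ 6) * qpoch (q ^+ 3) (q ^+ 6)
    * qpoch (q ^+ 5) (q ^+ 6) * E 2.
  rewrite [E 1](qpoch_dissect2 q q0); congr (_ * _).
  rewrite (qpoch_dissect3 _ (qX0 _)) -!exprM.
  by rewrite -!exprS.
have -> : E 3 = qpoch (q ^+ 3) (q ^+ 6) * E 6.
  by rewrite [E 3](qpoch_dissect2 _ (qX0 _)) -!exprM -exprD.
rewrite !opprK -/(E 6).
move: (qpoch _ _) (qpoch _ _) (qpoch _ _) (E 2) (E 6) => A B C D F; ring.
Qed.

(** As a = b, the classes of 1 and -1 modulo 3 coincide, whence the 2. *)
Lemma theta_phi_dissect : theta (- q) (- q) =
  theta (- q ^+ 9) (- q ^+ 9) - 2 * q * theta (- (q ^+ 3) ^+ 5) (- q ^+ 3).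
Proof.
rewrite theta_dissect3; last by rewrite mulrNN coef0_fpsM q0 mulr0.
have -> : (- q) ^+ 6 * (- q) ^+ 3 = - q ^+ 9 by ring.
have -> : (- q) ^+ 3 * (- q) ^+ 6 = - q ^+ 9 by ring.
have -> : (- q) ^+ 9 * (- q) ^+ 6 = - (q ^+ 3) ^+ 5 by ring.
have -> : (- q) ^+ 3 = - q ^+ 3 by ring.
move: (theta _ _) (theta _ _) => A B; ring.
Qed.

(** For a = 1 and b = q the first two components agree by [theta_sym], whence the 2. *)
Lemma theta_psi_dissect :
  theta 1 q = 2 * theta ((q ^+ 3) ^+ 2) (q ^+ 3) + q * theta 1 (q ^+ 9).
Proof.
have q10 : (1 * q) 0%N = 0 by rewrite mul1r.
rewrite (theta_dissect3 q10) !expr1n !mul1r !mulr1.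
have -> : theta (q ^+ 9) 1 = theta 1 (q ^+ 9).
  by apply: theta_sym; [rewrite mulr1; apply: qX0 | exact: lregX | exact: lreg1].
have -> : theta (q ^+ 3) (q ^+ 6) = theta (q ^+ 6) (q ^+ 3).
  by apply: theta_sym; [rewrite -exprD; apply: qX0 | exact: lregX | exact: lregX].
rewrite -exprM; move: (theta _ _) (theta _ _) => A B; ring.
Qed.

End ThetaProducts.

(** E_n at an arbitrary base, since the norm argument evaluates it at wq and w^2 q as well as at
    q. *)
HB.lock Definition eulerq (R : comUnitRingType) (q : fps R) (n : nat) : fps R :=
  qpoch (q ^+ n) (q ^+ n).

Lemma eulerqE (R : comUnitRingType) (q : fps R) n :
  qpoch (q ^+ n) (q ^+ n) = eulerq q n.
Proof. by rewrite eulerq.unlock. Qed.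

Lemma eulerq_unit (R : comUnitRingType) (q : fps R) n :
  q 0%N = 0 -> (0 < n)%N -> eulerq q n \is a GRing.unit.
Proof. by move=> q0 n0; rewrite -eulerqE qpoch_unit ?coef0_fpsX. Qed.

Lemma eulerqX (R : comUnitRingType) (q : fps R) m n :
  eulerq (q ^+ m) n = eulerq q (m * n).
Proof. by rewrite -!eulerqE exprM. Qed.

Lemma eulerqX_eq (R : comUnitRingType) (q : fps R) m n k :
  (m * n)%N = k -> eulerq (q ^+ m) n = eulerq q k.
Proof. by rewrite eulerqX => ->. Qed.

(** The product p1 s1 = 2 e1 e2 is expanded through the two dissections; its q term is p9 s9 - 4 c o
    = (2 - 4) e9 e18. Inverses enter as variables with e i = 1, which turns everything into a ring
    identity modulo these relations. *)
Lemma cubic_algebra (R : comNzRingType) (q p1 p9 o s1 s9 c : R)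
    (e1 e2 e3 e6 e9 e18 i1 i2 i3 i6 i9 i18 : R) :
  e1 * i1 = 1 -> e2 * i2 = 1 -> e3 * i3 = 1 ->
  e6 * i6 = 1 -> e9 * i9 = 1 -> e18 * i18 = 1 ->
  p1 * e2 = e1 ^+ 2 -> s1 * e1 = 2 * e2 ^+ 2 ->
  p9 * e18 = e9 ^+ 2 -> s9 * e9 = 2 * e18 ^+ 2 ->
  c * (e3 * e18) = e6 * e9 ^+ 2 -> o * (e6 * e9) = e3 * e18 ^+ 2 ->
  p1 = p9 - 2 * q * o -> s1 = 2 * c + q * s9 ->
  2 * (e1 * e2) = 2 * (e9 * e18 *
    (e6 * e9 ^+ 3 * (i3 * i18 ^+ 3) - q
      - 2 * q ^+ 2 * (e3 * e18 ^+ 3 * (i6 * i9 ^+ 3)))).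
Proof.
move=> h1 h2 h3 h6 h9 h18 P1 S1 P9 S9 C O dp ds.
have -> : 2 * (e1 * e2) = p1 * s1.
  have -> : p1 = e1 ^+ 2 * i2 by rewrite -P1 -mulrA h2 mulr1.
  have -> : s1 = 2 * e2 ^+ 2 * i1 by rewrite -S1 -mulrA h1 mulr1.
  ring: h1 h2.
have P9' : p9 = e9 ^+ 2 * i18 by rewrite -P9 -mulrA h18 mulr1.
have S9' : s9 = 2 * e18 ^+ 2 * i9 by rewrite -S9 -mulrA h9 mulr1.
have C' : c = e6 * e9 ^+ 2 * (i3 * i18).
  by rewrite -C -mulrA mulrACA h3 h18 !mulr1.
have O' : o = e3 * e18 ^+ 2 * (i6 * i9).
  by rewrite -O -mulrA mulrACA h6 h9 !mulr1.
rewrite dp ds P9' S9' C' O'; ring: h3 h6 h9 h18.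
Qed.

Lemma cubic_dissect (R : comUnitRingType) (q : fps R) (E := eulerq q) :
  q 0%N = 0 -> GRing.lreg q -> GRing.lreg (2 : fps R) ->
  E 1%N * E 2 = E 9 * E 18 *
    (E 6 * E 9 ^+ 3 / (E 3 * E 18 ^+ 3) - q
      - 2 * q ^+ 2 * (E 3 * E 18 ^+ 3 / (E 6 * E 9 ^+ 3))).
Proof.
move=> q0 regq reg2; apply: reg2.
have uE n : (0 < n)%N -> E n * (E n)^-1 = 1.
  by move=> n0; rewrite mulrV // eulerq_unit.
have q30 := coef0_fpsX q0 (isT : 0 < 3)%N.
have q90 := coef0_fpsX q0 (isT : 0 < 9)%N.
have regX n : GRing.lreg (q ^+ n) by exact: lregX.
have P1 := theta_phi q0 regq; have S1 := theta_psi q0 regq.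
have P9 := theta_phi q90 (regX 9); have S9 := theta_psi q90 (regX 9).
have C := theta_cubic q30 (regX 3); have O := theta_omega q30 (regX 3).
rewrite !eulerqE in P1 S1 P9 S9 C O.
rewrite (@eulerqX_eq _ _ _ 1 9) // (@eulerqX_eq _ _ _ 2 18) // in P9 S9.
rewrite (@eulerqX_eq _ _ _ 1 3) // (@eulerqX_eq _ _ _ 2 6) // in C O.
rewrite (@eulerqX_eq _ _ _ 3 9) // (@eulerqX_eq _ _ _ 6 18) // in C O.
have unE n : (0 < n)%N -> E n \is a GRing.unit by exact: eulerq_unit.
have invE m n : (0 < m)%N -> (0 < n)%N ->
    (E m * E n ^+ 3)^-1 = (E m)^-1 * (E n)^-1 ^+ 3.
  by move=> m0 n0; rewrite invrM ?unitrX ?unE // -exprVn mulrC.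
rewrite (invE 3 18 isT isT) (invE 6 9 isT isT).
exact: (cubic_algebra (uE 1%N isT) (uE 2 isT) (uE 3 isT) (uE 6 isT) (uE 9 isT)
  (uE 18 isT) P1 S1 P9 S9 C O (theta_phi_dissect q0) (theta_psi_dissect q0 regq)).
Qed.

(** * Norms over the cube roots of unity and the inverse of E_1 E_2 *)

(** Factors with exponent divisible by 3 are the same at q, cq and c^2 q and give E_3^3; the others
    combine by [qpoch_cube] into (q^3; q^9)_oo (q^6; q^9)_oo = E_3/E_9. *)
Lemma euler_norm (R : comUnitRingType) (c q : fps R) :
  1 + c + c ^+ 2 = 0 -> q 0%N = 0 ->
  eulerq q 1 * eulerq (c * q) 1 * eulerq (c ^+ 2 * q) 1 * eulerq q 9
    = eulerq q 3 ^+ 4.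
Proof.
move=> c0 q0.
have c3 : c ^+ 3 = 1.
  by apply: subr0_eq; rewrite -[RHS](mul0r (c - 1)) -c0; ring.
have cq0 d : (d * q) 0%N = 0 by rewrite coef0_fpsM q0 mulr0.
have q30 : (q ^+ 3) 0%N = 0 by apply: coef0_fpsX.
have dis d : d ^+ 3 = 1 -> eulerq (d * q) 1 =
    qpoch (d * q) (q ^+ 3) * qpoch (d ^+ 2 * q ^+ 2) (q ^+ 3) * eulerq q 3.
  move=> d3; rewrite -!eulerqE expr1 (qpoch_dissect3 _ (cq0 d)) exprMn d3 mul1r.
  by rewrite -expr2 -exprS !exprMn d3 mul1r.
have d1 := dis 1 (expr1n _ _); rewrite expr1n !mul1r in d1.
rewrite d1 (dis _ c3) dis; last by rewrite exprAC c3 expr1n.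
have -> : (c ^+ 2) ^+ 2 = c by rewrite -exprM exprSr c3 mul1r.
have n1 := qpoch_cube q c0 q30.
have n2 := qpoch_cube (q ^+ 2) c0 q30.
have -> : eulerq q 3 ^+ 4 = eulerq q 3 ^+ 3 *
    (qpoch (q ^+ 3) (q ^+ 3 ^+ 3) * qpoch (q ^+ 2 ^+ 3) (q ^+ 3 ^+ 3)
      * eulerq q 9).
  rewrite exprSr; congr (_ * _).
  rewrite -[in LHS]eulerqE (qpoch_dissect3 _ q30) -(@eulerqX_eq _ _ 3 3 9) //.
  by rewrite -eulerqE -!exprM -!exprD.
rewrite -n1 -n2.
move: (qpoch _ _) (qpoch _ _) (qpoch _ _) (qpoch _ _) (qpoch _ _) (qpoch _ _).
move: (eulerq _ _) (eulerq _ _) => *; ring.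
Qed.

(** The factorization of A^3 + B^3 + C^3 - 3ABC over the cube roots of unity, with A = y, B = -q, C
    = -2 q^2 x. *)
Lemma cubic_factor (R : comNzRingType) (x y q c : R) : 1 + c + c ^+ 2 = 0 ->
  (y - q - 2 * q ^+ 2 * x) * (y - c * q - 2 * (c * q) ^+ 2 * x)
    * (y - c ^+ 2 * q - 2 * (c ^+ 2 * q) ^+ 2 * x) =
  y ^+ 3 - q ^+ 3 - 8 * q ^+ 6 * x ^+ 3 - 6 * q ^+ 3 * (x * y).
Proof.
move=> c0; have c3 : c ^+ 3 = 1.
  by apply: subr0_eq; rewrite -[RHS](mul0r (c - 1)) -c0; ring.
have c4 : (c ^+ 2) ^+ 2 = c by rewrite -exprM exprSr c3 mul1r.
have cd : c * c ^+ 2 = 1 by rewrite -exprS.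
rewrite [(c * q) ^+ 2]exprMn [(c ^+ 2 * q) ^+ 2]exprMn c4.
(* With d for c^2, the last two factors multiply to an expression symmetric in c and d, hence known
   from c + d = -1 and cd = 1. *)
move: (c ^+ 2) c0 cd => d c0 cd.
have s : c + d = -1 by apply: (addrI 1); rewrite addrA c0 subrr.
transitivity ((y - q - 2 * q ^+ 2 * x) * (y ^+ 2 - (c + d) * (y * q)
   - 2 * (c + d) * (y * q ^+ 2 * x) + (c * d) * q ^+ 2
   + 2 * ((c + d) ^+ 2 - 2 * (c * d)) * (q ^+ 3 * x)
   + 4 * (c * d) * (q ^+ 4 * x ^+ 2))); first by ring.
by rewrite s cd; ring.
Qed.

(** If d^3 = 1 then E_n is the same at dq as at q for every n divisible by 3. So x and y are common
    to the three conjugate dissections, and [cubic_factor] multiplies these with xy = 1. *)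
Lemma cubic_norm (R : comUnitRingType) (c q : fps R) (E := eulerq q)
    (x := E 3 * E 18 ^+ 3 / (E 6 * E 9 ^+ 3))
    (y := E 6 * E 9 ^+ 3 / (E 3 * E 18 ^+ 3)) :
  1 + c + c ^+ 2 = 0 -> q 0%N = 0 -> GRing.lreg q -> GRing.lreg (2 : fps R) ->
  (E 3 * E 6) ^+ 4 =
    (E 9 * E 18) ^+ 4 * (y ^+ 3 - 7 * q ^+ 3 - 8 * q ^+ 6 * x ^+ 3).
Proof.
move=> c0 q0 regq reg2.
have c3 : c ^+ 3 = 1.
  by apply: subr0_eq; rewrite -[RHS](mul0r (c - 1)) -c0; ring.
have c23 : (c ^+ 2) ^+ 3 = 1 by rewrite exprAC c3 expr1n.
have unE n : (0 < n)%N -> E n \is a GRing.unit by exact: eulerq_unit.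
have xy : x * y = 1.
  rewrite /x /y mulrACA [X in _ * X]mulrC -invrM ?unitrM ?unitrX ?unE //.
  by rewrite [X in X^-1]mulrC mulrV ?unitrM ?unitrX ?unE.
have dis d : d ^+ 3 = 1 -> eulerq (d * q) 1 * eulerq (d * q) 2 =
    E 9 * E 18 * (y - d * q - 2 * (d * q) ^+ 2 * x).
  move=> d3; have dE n : eulerq (d * q) (3 * n) = E (3 * n)%N.
    by rewrite /E -!eulerqX exprMn d3 mul1r.
  have dq0 : (d * q) 0%N = 0 by rewrite coef0_fpsM q0 mulr0.
  have regdq : GRing.lreg (d * q).
    apply: lregM regq; have du : d \is a GRing.unit.
      by apply/unitrPr; exists (d ^+ 2); rewrite -exprS.
    exact: mulrI du.
  have := cubic_dissect dq0 regdq reg2.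
  by rewrite (dE 1%N) (dE 2) (dE 3) (dE 6).
have n1 := euler_norm c0 q0.
have q20 : (q ^+ 2) 0%N = 0 by apply: coef0_fpsX.
have n2 := euler_norm c0 q20.
have d1 := dis 1 (expr1n _ _); have dc := dis _ c3; have dc2 := dis _ c23.
rewrite !mul1r in d1.
rewrite (@eulerqX_eq _ _ 2 1 2) // (@eulerqX_eq _ _ 2 9 18) // in n2.
rewrite (@eulerqX_eq _ _ 2 3 6) // in n2.
(* Since (c^2 q)^2 = c q^2, squaring the base exchanges the two nontrivial conjugates. *)
have e1 : eulerq (c * q ^+ 2) 1 = eulerq (c ^+ 2 * q) 2.
  rewrite -(@eulerqX_eq _ (_ * q) 2 1 2) // exprMn -exprM.
  by rewrite (exprSr c 3) c3 mul1r.
have e2 : eulerq (c ^+ 2 * q ^+ 2) 1 = eulerq (c * q) 2.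
  by rewrite -(@eulerqX_eq _ (_ * q) 2 1 2) // exprMn.
rewrite e1 e2 in n2; rewrite exprMn -n1 -n2.
transitivity (eulerq q 1 * eulerq q 2 * (eulerq (c * q) 1 * eulerq (c * q) 2)
    * (eulerq (c ^+ 2 * q) 1 * eulerq (c ^+ 2 * q) 2) * (E 9 * E 18)).
  rewrite /E; move: (eulerq q 1) (eulerq q 2) (eulerq q 9) (eulerq q 18).
  move: (eulerq _ _) (eulerq _ _) (eulerq _ _) (eulerq _ _) => *; ring.
rewrite d1 dc dc2; have := cubic_factor x y q c0; rewrite xy mulr1.
have -> : forall z t : fps R, z - q ^+ 3 - 8 * q ^+ 6 * t - 6 * q ^+ 3 =
    z - 7 * q ^+ 3 - 8 * q ^+ 6 * t.
  by move=> z t; ring.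
move=> <-; move: (E 9) (E 18) (y - q - _) (y - c * q - _) => e9 e18 u v.
move: (y - c ^+ 2 * q - _) => w; ring.
Qed.

(** The bracket z is the cofactor A^2 + B^2 + C^2 - AB - BC - CA of A + B + C in A^3 + B^3 + C^3 -
    3ABC, simplified by xy = 1. *)
Lemma cubic_inverse (R : comUnitRingType) (c q : fps R) (E := eulerq q)
    (x := E 3 * E 18 ^+ 3 / (E 6 * E 9 ^+ 3))
    (y := E 6 * E 9 ^+ 3 / (E 3 * E 18 ^+ 3)) :
  1 + c + c ^+ 2 = 0 -> q 0%N = 0 -> GRing.lreg q -> GRing.lreg (2 : fps R) ->
  (E 1%N * E 2)^-1 = (E 9 * E 18) ^+ 3 / (E 3 * E 6) ^+ 4 *
    (y ^+ 2 - 2 * q ^+ 3 * x + q * (y + 4 * q ^+ 3 * x ^+ 2) + 3 * q ^+ 2).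
Proof.
move=> c0 q0 regq reg2; set z := _ + 3 * _.
have unE n : (0 < n)%N -> E n \is a GRing.unit by exact: eulerq_unit.
have xy : x * y = 1.
  rewrite /x /y mulrACA [X in _ * X]mulrC -invrM ?unitrM ?unitrX ?unE //.
  by rewrite [X in X^-1]mulrC mulrV ?unitrM ?unitrX ?unE.
have uE12 : E 1%N * E 2 \is a GRing.unit by rewrite unitrM !unE.
have uE36 : (E 3 * E 6) ^+ 4 \is a GRing.unit by rewrite unitrX // unitrM !unE.
apply: (mulrI uE12); rewrite mulrV // -[LHS](mulrV uE36).
rewrite {1}(cubic_norm c0 q0 regq reg2) (cubic_dissect q0 regq reg2).
rewrite -/E -/x -/y.
have -> : y ^+ 3 - 7 * q ^+ 3 - 8 * q ^+ 6 * x ^+ 3 =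
    (y - q - 2 * q ^+ 2 * x) * z.
  transitivity (y ^+ 3 - q ^+ 3 - 8 * q ^+ 6 * x ^+ 3 - 6 * q ^+ 3 * (x * y)).
    by rewrite xy; move: (x ^+ 3) => t; ring.
  have -> : z = y ^+ 2 - 2 * q ^+ 3 * x + q * (y + 4 * q ^+ 3 * x ^+ 2)
      + q ^+ 2 + 2 * q ^+ 2 * (x * y).
    by rewrite xy /z; move: (_ + q * _) => t; ring.
  move: x y {xy z} => x y; ring.
move: (y - q - _) ((E 3 * E 6) ^- 4) => u v; move: z (E 9) (E 18) => z e9 e18.
ring.
Qed.

(** * Dilations and arithmetic progressions *)

(** Respecting congruences modulo q^N is the continuity that lets a ring morphism pass through the
    infinite product. *)
Lemma rmorph_qpoch (R S : comUnitRingType) (phi : {rmorphism fps R -> fps S})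
    (a q : fps R) :
  (forall N f g, fps_eqmod N f g -> fps_eqmod N (phi f) (phi g)) ->
  q 0%N = 0 -> phi q 0%N = 0 -> phi (qpoch a q) = qpoch (phi a) (phi q).
Proof.
move=> cont q0 pq0; apply: fps_eqmodP => N.
apply: (eqmod_trans (cont _ _ _ (qpoch_eqmod a q0 (leqnn N)))).
rewrite rmorph_prod; under eq_bigr do rewrite rmorphB rmorph1 rmorphM rmorphXn.
exact/eqmod_sym/qpoch_eqmod.
Qed.

Definition fps_map (R S : comUnitRingType) (phi : R -> S) (f : fps R) : fps S :=
  Fps (fun n => phi (f n)).

Section FpsMap.
Variables (R S : comUnitRingType) (phi : {rmorphism R -> S}).

Fact fps_map_is_zmod_morphism : zmod_morphism (fps_map phi).
Proof. by move=> f g; apply: fpsP => n; rewrite /= rmorphB. Qed.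

Fact fps_map_is_monoid_morphism : monoid_morphism (fps_map phi).
Proof.
split=> [|f g]; apply: fpsP => n; first by rewrite /= rmorph_nat.
rewrite [LHS]/= coef_fpsM rmorph_sum; apply: eq_bigr => i _.
by rewrite rmorphM.
Qed.

HB.instance Definition _ :=
  GRing.isZmodMorphism.Build (fps R) (fps S) (fps_map phi)
    fps_map_is_zmod_morphism.
HB.instance Definition _ :=
  GRing.isMonoidMorphism.Build (fps R) (fps S) (fps_map phi)
    fps_map_is_monoid_morphism.

Lemma fps_mapX : fps_map phi fpsX = fpsX.
Proof. by apply: fpsP => n; rewrite /= rmorph_nat. Qed.

Lemma fps_map_eulerq k : (0 < k)%N -> fps_map phi (eulerq fpsX k) = eulerq fpsX k.
Proof.
move=> k0; have X0 (T : comUnitRingType) : (fpsX ^+ k : fps T) 0%N = 0.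
  by rewrite coef0_fpsX.
have mX : fps_map phi (fpsX ^+ k) = fpsX ^+ k.
  by rewrite rmorphXn; congr (_ ^+ _); apply: fps_mapX.
rewrite -!eulerqE -[in RHS]mX; apply: rmorph_qpoch (X0 R) _.
  by move=> N f g fg n nN; congr (phi _); apply: fg.
exact: etrans (congr1 (fun f : fps S => f 0%N) mX) (X0 S).
Qed.

End FpsMap.

Definition extract (R : comUnitRingType) m r (f : fps R) : fps R :=
  Fps (fun n => f (m * n + r)%N).

(** The substitution of q^m for q. *)
Definition dilate (R : comUnitRingType) m (f : fps R) : fps R :=
  Fps (fun n => if (m %| n)%N then f (n %/ m)%N else 0).

Section Dilation.
Variables (R : comUnitRingType) (m : nat).
Implicit Types f g : fps R.

Lemma extractD r f g : extract m r (f + g) = extract m r f + extract m r g.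
Proof. exact: fpsP. Qed.

Lemma extract_dilateM r f g : (r < m)%N ->
  extract m r (dilate m g * f) = g * extract m r f.
Proof.
move=> rm; apply: fpsP => n; rewrite [LHS]/= coef_fpsM.
pose G i := dilate m g i * f (m * n + r - i)%N.
(* Padding by zeros extends the convolution to (n+1)m terms, which split by residue modulo m; only
   residue 0 survives the dilated factor. *)
pose F i := if (i < (m * n + r).+1)%N then G i else 0.
transitivity (\sum_(i < n.+1 * m) F i).
  rewrite /F -big_mkcond /= -(big_ord_widen _ G) //.
  by rewrite mulSn mulnC; lia.
rewrite big_ord_mul (bigD1 (Ordinal (leq_ltn_trans (leq0n r) rm))) //=.
rewrite [X in _ + X]big1 ?addr0 => [|i i0].
  apply: eq_bigr => -[i /= iN] _; rewrite /F /G add0n.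
  have -> : (m * i < (m * n + r).+1)%N by nia.
  by rewrite /= dvdn_mulr // mulKn; [congr (_ * f _); nia | lia].
rewrite big1 // => j _; rewrite /F /G /=; case: ifP => // _.
rewrite addnC mulnC dvdn_addr ?dvdn_mull //.
have -> : (m %| i)%N = false.
  have := ltn_ord i; case: i i0 => i im /= i0 _.
  by rewrite gtnNdvd // lt0n; apply: contra i0 => /eqP i0; apply/eqP/val_inj.
by rewrite mul0r.
Qed.

Hypothesis m_gt0 : (0 < m)%N.

Lemma extract_dilate r f : (r < m)%N ->
  extract m r (dilate m f) = if r == 0%N then f else 0.
Proof.
move=> rm; apply: fpsP => n /=; rewrite dvdn_addr ?dvdn_mulr //.
case: eqP => [->|/eqP r0]; first by rewrite dvdn0 addn0 mulKn.
by rewrite gtnNdvd // lt0n.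
Qed.

Lemma extractP f g : (forall r, (r < m)%N -> extract m r f = extract m r g) ->
  f = g.
Proof.
move=> fg; apply: fpsP => n; have nm : (n %% m < m)%N by rewrite ltn_mod.
have := congr1 (fun h : fps R => h (n %/ m)%N) (fg _ nm).
by rewrite /= mulnC -divn_eq.
Qed.

Fact dilate_is_zmod_morphism : zmod_morphism (@dilate R m).
Proof. by move=> f g; apply: fpsP => n /=; case: ifP; rewrite ?subr0. Qed.

(** Both sides are compared on each residue class; for products [extract_dilateM] is applied with a
    dilated second factor. *)
Fact dilate_is_monoid_morphism : monoid_morphism (@dilate R m).
Proof.
split=> [|f g]; apply: extractP => r rm.
  rewrite extract_dilate //; apply: fpsP => n /=.
  have -> : (m * n + r == 0 = (r == 0) && (n == 0))%N by apply/eqP/andP; nia.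
  by case: (r == 0%N).
rewrite extract_dilate // extract_dilateM // extract_dilate //.
by case: eqP => //; rewrite mulr0.
Qed.

End Dilation.

Section DilateMorphism.
Variables (R : comUnitRingType) (m : nat).

HB.instance Definition _ :=
  GRing.isZmodMorphism.Build (fps R) (fps R) (@dilate R m.+1)
    (@dilate_is_zmod_morphism R m.+1).
HB.instance Definition _ :=
  GRing.isMonoidMorphism.Build (fps R) (fps R) (@dilate R m.+1)
    (@dilate_is_monoid_morphism R m.+1 isT).

Lemma dilateX : dilate m.+1 (fpsX : fps R) = fpsX ^+ m.+1.
Proof.
apply: fpsP => n; rewrite coef_fpsXn /=.
case: (boolP (m.+1 %| n)%N) => [/dvdnP[k ->]|mn].
  rewrite mulnK //; congr (nat_of_bool _)%:R.
  by rewrite -{2}[m.+1]mul1n eqn_pmul2r.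
by case: eqP mn => // ->; rewrite dvdnn.
Qed.

Lemma dilate_eulerq k : (0 < k)%N ->
  dilate m.+1 (eulerq (fpsX : fps R) k) = eulerq fpsX (m.+1 * k).
Proof.
move=> k0; have X0 j : (0 < j)%N -> (fpsX ^+ j : fps R) 0%N = 0.
  by move=> j0; rewrite coef0_fpsX.
have mX : dilate m.+1 (fpsX ^+ k) = fpsX ^+ (m.+1 * k) :> fps R.
  by rewrite rmorphXn exprM; congr (_ ^+ _); apply: dilateX.
rewrite -!eulerqE -[in RHS]mX; apply: rmorph_qpoch (X0 k k0) _.
  move=> N f g fg n nN /=; case: ifP => // _; apply: fg.
  exact: leq_ltn_trans (leq_div _ _) nN.
apply: etrans (congr1 (fun f : fps R => f 0%N) mX) (X0 _ _).
by rewrite muln_gt0.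
Qed.

End DilateMorphism.

(* The terms of (p + z q + 3 z^2)^4 with exponent 2 mod 3 in z, p and q counting
   as functions of z^3; divided by z^2 and with z^3 renamed z. *)
Definition quartic_part (S : comNzRingType) (p q z : S) : S :=
  12 * p ^+ 3 + 6 * p ^+ 2 * q ^+ 2 + 108 * z * p * q + 12 * z * q ^+ 3
    + 81 * z ^+ 2.

(** Here [phi] plays the dilation by 3, and the multinomial terms are sorted by their exponent of z
    modulo 3. *)
Lemma quartic_trisect (S : comNzRingType) (phi : {rmorphism S -> S}) (z p q : S) :
  phi z = z ^+ 3 ->
  (phi p + z * phi q + 3 * z ^+ 2) ^+ 4 =
  phi (p ^+ 4 + z * (4 * p * q ^+ 3 + 36 * p ^+ 2 * q)
     + z ^+ 2 * (54 * q ^+ 2 + 108 * p))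
  + z * phi (4 * p ^+ 3 * q + z * (q ^+ 4 + 36 * p * q ^+ 2 + 54 * p ^+ 2)
     + 108 * z ^+ 2 * q)
  + z ^+ 2 * phi (quartic_part p q z).
Proof. by move=> pz; rewrite /quartic_part; ring: pz. Qed.

(** Multiplied by the 3 of the series of a(3n+2), these are the five coefficients of the theorem,
    for instance 3 * 513 = 19 * 3^4. *)
Lemma quartic_part_expand (S : comNzRingType) (x y z : S) : x * y = 1 ->
  quartic_part (y ^+ 2 - 2 * z * x) (y + 4 * z * x ^+ 2) z =
  18 * y ^+ 6 + 72 * z * y ^+ 3 + 513 * z ^+ 2 - 576 * z ^+ 3 * x ^+ 3
    + 1152 * z ^+ 4 * x ^+ 6.
Proof. by move=> xy; rewrite /quartic_part; ring: xy. Qed.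

Lemma quartic_part_eta (S : comNzRingType)
    (z e1 e2 e3 e6 i1 i2 i3 i6 x y k d1 d2 d3 d4 d5 : S) :
  e1 * i1 = 1 -> e2 * i2 = 1 -> e3 * i3 = 1 -> e6 * i6 = 1 ->
  x = e1 * e6 ^+ 3 * (i2 * i3 ^+ 3) -> y = e2 * e3 ^+ 3 * (i1 * i6 ^+ 3) ->
  k = (e3 * e6) ^+ 3 * (i1 * i2) ^+ 4 ->
  d1 = i1 ^+ 19 * i2 ^+ 7 * i6 ^+ 6 -> d2 = i1 ^+ 16 * i2 ^+ 10 ->
  d3 = i1 ^+ 13 * i2 ^+ 13 -> d4 = i1 ^+ 10 * i2 ^+ 16 ->
  d5 = i1 ^+ 7 * i2 ^+ 19 * i3 ^+ 6 ->
  3 * (e1 * e2) ^+ 3 * k ^+ 4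
    * quartic_part (y ^+ 2 - 2 * z * x) (y + 4 * z * x ^+ 2) z =
  2 * 3 ^+ 3 * (e3 ^+ 30 * d1) + 8 * 3 ^+ 3 * z * (e3 ^+ 21 * e6 ^+ 3 * d2)
  + 19 * 3 ^+ 4 * z ^+ 2 * (e3 ^+ 12 * e6 ^+ 12 * d3)
  - 64 * 3 ^+ 3 * z ^+ 3 * (e3 ^+ 3 * e6 ^+ 21 * d4)
  + 128 * 3 ^+ 3 * z ^+ 4 * (e6 ^+ 30 * d5).
Proof.
move=> h1 h2 h3 h6 xE yE -> -> -> -> -> ->.
have xy : x * y = 1 by rewrite xE yE; ring: h1 h2 h3 h6.
rewrite (quartic_part_expand z xy) xE yE.
ring: h1 h2 h3 h6.
Qed.

(** The right-hand side of the theorem with the Euler products as arguments, ready for transport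
    along ring morphisms. *)
Definition cubic_rhs (S : comUnitRingType) (e1 e2 e3 e6 z : S) : S :=
    2 * 3 ^+ 3 * (e3 ^+ 30 / (e1 ^+ 19 * e2 ^+ 7 * e6 ^+ 6))
    + 8 * 3 ^+ 3 * z * (e3 ^+ 21 * e6 ^+ 3 / (e1 ^+ 16 * e2 ^+ 10))
    + 19 * 3 ^+ 4 * z ^+ 2 * (e3 ^+ 12 * e6 ^+ 12 / (e1 ^+ 13 * e2 ^+ 13))
    - 64 * 3 ^+ 3 * z ^+ 3 * (e3 ^+ 3 * e6 ^+ 21 / (e1 ^+ 10 * e2 ^+ 16))
    + 128 * 3 ^+ 3 * z ^+ 4 *
      (e6 ^+ 30 / (e1 ^+ 7 * e2 ^+ 19 * e3 ^+ 6)).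

Lemma rmorph_cubic_rhs (S T : comUnitRingType) (phi : {rmorphism S -> T})
    (e1 e2 e3 e6 z : S) (f1 f2 f3 f6 u : T) :
  e1 \is a GRing.unit -> e2 \is a GRing.unit -> e3 \is a GRing.unit ->
  e6 \is a GRing.unit -> phi e1 = f1 -> phi e2 = f2 -> phi e3 = f3 ->
  phi e6 = f6 -> phi z = u ->
  phi (cubic_rhs e1 e2 e3 e6 z) = cubic_rhs f1 f2 f3 f6 u.
Proof.
move=> u1 u2 u3 u6 <- <- <- <- <-.
have divE a b : b \is a GRing.unit -> phi (a / b) = phi a / phi b.
  by move=> ub; rewrite rmorphM rmorphV.
rewrite /cubic_rhs !rmorphD rmorphN.
by congr (_ + _ + _ - _ + _);
  rewrite rmorphM divE ?unitrM ?unitrX ?u1 ?u2 ?u3 ?u6 //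
          ?rmorphM ?rmorphXn ?rmorph_nat.
Qed.

(** * The series of a(3n+2) and a(9n+8) *)

Section CubicPartition.
Variables (R : comUnitRingType) (c : fps R).
Hypotheses (c0 : 1 + c + c ^+ 2 = 0) (reg2 : GRing.lreg (2 : fps R)).

Let X : fps R := fpsX.
Let E := eulerq X.

Let X0 : X 0%N = 0. Proof. by []. Qed.

Let regX : GRing.lreg X.
Proof.
move=> f g fg; apply: fpsP => n.
have XM (h : fps R) : (X * h) n.+1 = h n.
  rewrite coef_fpsM 2!big_ord_recl /= mul0r add0r mul1r subSS subn0.
  by rewrite big1 ?addr0 // => i _; rewrite mul0r.
by rewrite -(XM f) -(XM g) fg.
Qed.

Let unE n : (0 < n)%N -> E n \is a GRing.unit.
Proof. exact: eulerq_unit. Qed.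

(** The quantities x and y of [cubic_inverse] and its prefactor are the dilations by 3 of these [x],
    [y] and [K]. *)
Let x := E 1%N * E 6 ^+ 3 / (E 2 * E 3 ^+ 3).
Let y := E 2 * E 3 ^+ 3 / (E 1%N * E 6 ^+ 3).
Let K := (E 3 * E 6) ^+ 3 / (E 1%N * E 2) ^+ 4.
Let P := y ^+ 2 - 2 * X * x.
Let Q := y + 4 * X * x ^+ 2.

Let dE n : (0 < n)%N -> dilate 3 (E n) = E (3 * n)%N.
Proof. exact: dilate_eulerq. Qed.

Let dM (f g : fps R) : dilate 3 (f * g) = dilate 3 f * dilate 3 g.
Proof. exact: rmorphM. Qed.

Let dX (f : fps R) n : dilate 3 (f ^+ n) = dilate 3 f ^+ n.
Proof. exact: rmorphXn. Qed.

Let dn n : dilate 3 n%:R = n%:R :> fps R.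
Proof. exact: rmorph_nat. Qed.

Lemma inv_euler12_dissect :
  (E 1%N * E 2)^-1 = dilate 3 K * (dilate 3 P + X * dilate 3 Q + 3 * X ^+ 2).
Proof.
rewrite (cubic_inverse c0 X0 regX reg2).
have dV (f : fps R) : f \is a GRing.unit -> dilate 3 f^-1 = (dilate 3 f)^-1.
  exact: rmorphV.
have dD (f g : fps R) : dilate 3 (f + g) = dilate 3 f + dilate 3 g.
  exact: rmorphD.
have dB (f g : fps R) : dilate 3 (f - g) = dilate 3 f - dilate 3 g.
  exact: rmorphB.
have dq : dilate 3 X = X ^+ 3 by exact: dilateX.
have dE3 a b : (0 < a)%N -> (0 < b)%N ->
    dilate 3 (E a * E b ^+ 3) = E (3 * a)%N * E (3 * b)%N ^+ 3.
  by move=> a0 b0; rewrite dM dX !dE.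
have unE3 a b : (0 < a)%N -> (0 < b)%N -> E a * E b ^+ 3 \is a GRing.unit.
  by move=> a0 b0; rewrite unitrM unitrX !unE.
have dx : dilate 3 x = E 3 * E 18 ^+ 3 / (E 6 * E 9 ^+ 3).
  by rewrite /x dM (dV _ (unE3 2%N 3%N isT isT)) (dE3 1%N 6%N) // (dE3 2%N 3%N).
have dy : dilate 3 y = E 6 * E 9 ^+ 3 / (E 3 * E 18 ^+ 3).
  by rewrite /y dM (dV _ (unE3 1%N 6%N isT isT)) (dE3 1%N 6%N) // (dE3 2%N 3%N).
have dEE a b n : (0 < a)%N -> (0 < b)%N ->
    dilate 3 ((E a * E b) ^+ n) = (E (3 * a)%N * E (3 * b)%N) ^+ n.
  by move=> a0 b0; rewrite dX dM !dE.
have dK : dilate 3 K = (E 9 * E 18) ^+ 3 / (E 3 * E 6) ^+ 4.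
  rewrite /K dM dV; first by rewrite (dEE 3%N 6%N) // (dEE 1%N 2%N).
  by rewrite unitrX // unitrM !unE.
have dP : dilate 3 P = dilate 3 y ^+ 2 - 2 * X ^+ 3 * dilate 3 x.
  by rewrite /P dB dX dM dM dn dq.
have dQ : dilate 3 Q = dilate 3 y + 4 * X ^+ 3 * dilate 3 x ^+ 2.
  by rewrite /Q dD dM dM dX dn dq.
by rewrite dP dQ dK dx dy.
Qed.

Lemma extract3_dilate (f0 f1 f2 : fps R) :
  extract 3 2 (dilate 3 f0 + X * dilate 3 f1 + X ^+ 2 * dilate 3 f2) = f2.
Proof.
have eX k : (k < 3)%N -> extract 3 2 (X ^+ k) = (k == 2)%:R :> fps R.
  move=> k3; apply: fpsP => n; rewrite /= coef_fpsXn.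
  have -> : (3 * n + 2 == k = (k == 2) && (n == 0))%N by apply/eqP/andP; lia.
  by case: (k == 2%N).
have eXM f k : (k < 3)%N -> extract 3 2 (X ^+ k * dilate 3 f) = f * (k == 2)%:R.
  by move=> k3; rewrite mulrC extract_dilateM // eX.
rewrite !extractD extract_dilate // (eXM f1 1%N) // (eXM f2 2%N) //.
by rewrite mulr0 !add0r mulr1.
Qed.

(** Only 3 q^2 contributes exponents 2 mod 3, and the dilated [K] factors out. In particular 3
    divides a(3n+2). *)
Lemma extract3_inv_euler12 :
  extract 3 2 (E 1%N * E 2)^-1 = 3 * K.
Proof.
rewrite inv_euler12_dissect -[X in _ * (X + _ + _)]mul1r.
have -> : 3 * X ^+ 2 = X ^+ 2 * dilate 3 (3 : fps R).
  by rewrite rmorph_nat mulrC.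
by rewrite extract_dilateM // mul1r extract3_dilate mulrC.
Qed.

Lemma extract3_quartic (p q : fps R) :
  extract 3 2 ((dilate 3 p + X * dilate 3 q + 3 * X ^+ 2) ^+ 4) =
  quartic_part p q X.
Proof.
by rewrite (quartic_trisect p q (dilateX R 2)) extract3_dilate.
Qed.

Lemma extract9_inv_euler12 :
  extract 3 2 (extract 3 2 (E 1%N * E 2)^-1) =
  cubic_rhs (E 1%N) (E 2) (E 3) (E 6) X.
Proof.
have invM2 (a b : fps R) : a \is a GRing.unit -> b \is a GRing.unit ->
  (a * b)^-1 = a^-1 * b^-1 by move=> ua ub; rewrite invrM // mulrC.
have unEX n k : (0 < n)%N -> E n ^+ k \is a GRing.unit.
  by move=> n0; rewrite unitrX ?unE.
have invX2 a b m n : (0 < a)%N -> (0 < b)%N ->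
    (E a ^+ m * E b ^+ n)^-1 = (E a)^-1 ^+ m * (E b)^-1 ^+ n.
  by move=> a0 b0; rewrite (invM2 _ _ (unEX _ _ a0) (unEX _ _ b0)) !exprVn.
have invX3 a b d m n k : (0 < a)%N -> (0 < b)%N -> (0 < d)%N ->
    (E a ^+ m * E b ^+ n * E d ^+ k)^-1 =
    (E a)^-1 ^+ m * (E b)^-1 ^+ n * (E d)^-1 ^+ k.
  move=> a0 b0 d0; have uab : E a ^+ m * E b ^+ n \is a GRing.unit.
    by rewrite unitrM !unEX.
  by rewrite (invM2 _ _ uab (unEX _ _ d0)) invX2 // -[(E d ^+ k)^-1]exprVn.
(* As (E_3 E_6)^3 is the dilation of (E_1 E_2)^3, the whole prefactor of the quartic is dilated and
   leaves the second extraction. *)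
have dil : dilate 3 (3 * (E 1%N * E 2) ^+ 3 * K ^+ 4) =
    3 * (E 3 * E 6) ^+ 3 * dilate 3 K ^+ 4.
  by rewrite (dM (3 * _)) (dM 3) (dX K) (dX (_ * E 2)) (dM (E 1%N)) !dE // dn.
rewrite extract3_inv_euler12 {1}/K -exprVn inv_euler12_dissect.
rewrite [(dilate 3 K * _) ^+ 4]exprMn.
rewrite (mulrA 3) (mulrA (3 * _)) -dil extract_dilateM // extract3_quartic.
have xE : x = E 1%N * E 6 ^+ 3 * ((E 2)^-1 * (E 3)^-1 ^+ 3).
  by rewrite /x (invX2 2 3 1 3 isT isT)%N.
have yE : y = E 2 * E 3 ^+ 3 * ((E 1%N)^-1 * (E 6)^-1 ^+ 3).
  by rewrite /y (invX2 1 6 1 3 isT isT)%N.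
have KE : K = (E 3 * E 6) ^+ 3 * ((E 1%N)^-1 * (E 2)^-1) ^+ 4.
  by rewrite /K -exprVn (invX2 1 2 1 1 isT isT)%N.
have mV n : (0 < n)%N -> E n * (E n)^-1 = 1 by move=> n0; rewrite mulrV ?unE.
exact: (quartic_part_eta X (mV 1 isT) (mV 2 isT) (mV 3 isT) (mV 6 isT) xE yE KE
  (invX3 1 2 6 19 7 6 isT isT isT) (invX2 1 2 16 10 isT isT)
  (invX2 1 2 13 13 isT isT) (invX2 1 2 10 16 isT isT)
  (invX3 1 2 3 7 19 6 isT isT isT))%N.
Qed.

End CubicPartition.

(** * Descent from algebraic to integer coefficients *)

Lemma fps_map_inj (R S : comUnitRingType) (phi : R -> S) :
  injective phi -> injective (fps_map phi).
Proof.
move=> phi_inj f g fg; apply: fpsP => n; apply: phi_inj.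
exact: (congr1 (fun h : fps S => h n) fg).
Qed.

Definition fpsC (R : comUnitRingType) (a : R) : fps R :=
  Fps (fun n => if n is 0%N then a else 0).

Lemma fpsC_root3 (R : comUnitRingType) (w : R) :
  1 + w + w ^+ 2 = 0 -> 1 + fpsC w + fpsC w ^+ 2 = 0.
Proof.
move=> w0; have -> : fpsC w ^+ 2 = fpsC (w ^+ 2).
  apply: fpsP => n; rewrite expr2 coef_fpsM big_ord_recl big1 ?addr0 => [|i _].
    by case: n => [|n] /=; rewrite ?expr2 ?mulr0.
  by rewrite /= mul0r.
apply: fpsP => -[|n]; rewrite !coef_fpsD coef_fps1 /=; first exact: w0.
by rewrite !addr0.
Qed.

Theorem theorem1p2 :
  Fps (fun n : nat => cubic_partition (9 * n + 8)%N) =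
    2 * 3 ^+ 3 *
      (euler 3 ^+ 30 / (euler 1 ^+ 19 * euler 2 ^+ 7 * euler 6 ^+ 6))
    + 8 * 3 ^+ 3 * fpsX *
      (euler 3 ^+ 21 * euler 6 ^+ 3 / (euler 1 ^+ 16 * euler 2 ^+ 10))
    + 19 * 3 ^+ 4 * fpsX ^+ 2 *
      (euler 3 ^+ 12 * euler 6 ^+ 12 / (euler 1 ^+ 13 * euler 2 ^+ 13))
    - 64 * 3 ^+ 3 * fpsX ^+ 3 *
      (euler 3 ^+ 3 * euler 6 ^+ 21 / (euler 1 ^+ 10 * euler 2 ^+ 16))
    + 128 * 3 ^+ 3 * fpsX ^+ 4 *
      (euler 6 ^+ 30 / (euler 1 ^+ 7 * euler 2 ^+ 19 * euler 3 ^+ 6)).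
Proof.
rewrite -[RHS]/(cubic_rhs (euler 1) (euler 2) (euler 3) (euler 6) fpsX).
have [w w3] := C_prim_root_exists (isT : 0 < 3)%N.
have w0 : 1 + w + w ^+ 2 = 0 :> algC.
  have w1 : w - 1 != 0.
    rewrite subr_eq0; apply/eqP => w1.
    by have := prim_order_dvd w3 1; rewrite w1 expr1n eqxx.
  apply: (mulIf w1); rewrite mul0r.
  transitivity (w ^+ 3 - 1); first ring.
  by rewrite (prim_expr_order w3) subrr.
have reg2 : GRing.lreg (2 : fps algC).
  have u2 : (2 : fps algC) \is a GRing.unit.
    rewrite fps_unitE; have -> : (2 : fps algC) 0%N = 2 by [].
    by rewrite unitfE pnatr_eq0.
  exact: mulrI u2.
have key := extract9_inv_euler12 (fpsC_root3 w0) reg2.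
pose M : {rmorphism fps int -> fps algC} := fps_map (intr : int -> algC).
have ME k : (0 < k)%N -> M (euler k) = eulerq fpsX k.
  move=> k0.
  by rewrite -(fps_map_eulerq (intr : {rmorphism int -> algC}) k0) -eulerqE.
have ue k : (0 < k)%N -> euler k \is a GRing.unit := @euler_unit k.
apply: (@fps_map_inj _ _ (intr : int -> algC) (@intr_inj _)).
transitivity (M (cubic_rhs (euler 1) (euler 2) (euler 3) (euler 6) fpsX));
  last by [].
have MX : M fpsX = fpsX by exact: (fps_mapX (intr : {rmorphism int -> algC})).
rewrite (rmorph_cubic_rhs (ue 1 isT) (ue 2 isT) (ue 3 isT) (ue 6 isT)
  (ME 1 isT) (ME 2 isT) (ME 3 isT) (ME 6 isT) MX)%N -key.
have -> : (eulerq fpsX 1 * eulerq fpsX 2)^-1 = M (1 / (euler 1 * euler 2)).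
  have u12 : euler 1 * euler 2 \is a GRing.unit.
    by rewrite unitrM; apply/andP; split; apply: ue.
  rewrite div1r (rmorphV M u12); congr (_^-1); rewrite rmorphM.
  by rewrite -(ME 1%N isT) -(ME 2%N isT).
apply: fpsP => n; rewrite /= /cubic_partition.
(* The two extractions compose to the index 3(3n+2) + 2 = 9n + 8. *)
by congr ((_ _)%:~R); lia.
Qed.
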